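(* Let $p$ be an integer with $p\ge2$. Then $$\lim_{m\to\infty}\left(\sum_{1\le N_1<\cdots<N_m}\frac{1}{N_m^{p}\cdots N_1^{p}}\right)=0.$$
   Context: For each $m$, the series ranges over all strictly increasing $m$-tuples $(N_1,\ldots,N_m)$ of positive integers. *)

(* Defs.v *)
From mathcomp Require Import all_boot all_order all_algebra.
From mathcomp Require Import all_classical all_reals all_analysis.

Set Implicit Arguments.
Unset Strict Implicit.
Unset Printing Implicit Defensive.

Import Order.TTheory GRing.Theory Num.Theory.

Local Open Scope classical_set_scope.
Local Open Scope ring_scope.

(* A tuple N lists (N_1, ..., N_m) in this order, 0-based: N_i is [tnth N] at
   index i - 1. *)
Definition increasing_tuples (m : nat) : set (m.-tuple nat) :=
  [set N : m.-tuple nat | sorted ltn N /\ forall i : 'I_m, (0 < tnth N i)%N].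
Arguments increasing_tuples m : clear implicits.

(* The terms are nonnegative, so the series is the unordered sum in [0, +oo];
   it converges exactly when this value is < +oo. *)
Definition nested_series (R : realType) (p m : nat) : \bar R :=
  \esum_(N in increasing_tuples m)
    ((\prod_(i < m) ((tnth N i)%:R ^+ p)^-1 : R)%:E).

(* Main.v *)
Require Import Defs.
From mathcomp Require Import all_boot all_order all_algebra.
From mathcomp Require Import all_classical all_reals all_analysis.
From mathcomp Require Import ring lra.

(** Write a_k = 1 / k^p. A strictly increasing m-tuple is the same thing as an
    m-element set J of integers, and its term is the product of the a_k over
    k in J. The nested series is therefore the m-th elementary symmetric
    function of the a_k, that is, the coefficient of t^m in the generating
    product of the factors 1 + t a_k. As this product has nonnegative
    coefficients, every t > 0 gives

      t^m * nested_series p m <= prod_k (1 + t a_k) <= exp (t * sum_k a_k)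

    and the sum of the a_k is at most 2, by comparison of 1 / k^2 with the
    telescoping 1 / (k - 1) - 1 / k. Any fixed t > 1 now yields geometric decay
    in m; t = 2 is used, so that the series is at most exp 4 / 2^m.

    The bound on the infinite series is obtained on its finite partial sums
    (lemma [sum_sorted_tuples_le]), where all tuples have entries below some n
    and the expansion of the product is a finite sum over the subsets of 'I_n. *)

Set Implicit Arguments.
Unset Strict Implicit.
Unset Printing Implicit Defensive.

Import Order.TTheory GRing.Theory Num.Theory.
Import numFieldNormedType.Exports.

Local Open Scope classical_set_scope.
Local Open Scope ring_scope.

Definition support_below (n m : nat) (N : m.-tuple nat) : {set 'I_n} :=
  [set i : 'I_n | val i \in tval N].

Lemma prod_support_below (R : comPzRingType) (a : nat -> R) (n m : nat)
    (N : m.-tuple nat) :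
  sorted ltn N -> (forall x, x \in tval N -> (x < n)%N) ->
  \prod_(i < m) a (tnth N i) = \prod_(i in support_below n N) a i.
Proof.
move=> sN ltNn.
have uN : uniq N by apply: (sorted_uniq ltn_trans ltnn).
rewrite -(big_tuple _ _ N xpredT) /=.
under [RHS]eq_bigl do rewrite inE.
rewrite -(big_mkord (fun k => k \in tval N) a) -[RHS]big_filter.
apply: perm_big; apply: uniq_perm => //; first exact/filter_uniq/iota_uniq.
move=> x; rewrite mem_filter mem_index_iota /=.
by case: (boolP (x \in tval N)) => // /ltNn ->.
Qed.

(** A strictly increasing list is determined by its set of entries. *)
Lemma support_below_inj (n m : nat) (N N' : m.-tuple nat) :
  sorted ltn N -> sorted ltn N' ->
  (forall x, x \in tval N -> (x < n)%N) ->
  (forall x, x \in tval N' -> (x < n)%N) ->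
  support_below n N = support_below n N' -> N = N'.
Proof.
move=> sN sN' ltN ltN' /setP eqNN'; apply: val_inj.
apply: (irr_sorted_eq ltn_trans ltnn) => // x.
have [ltxn|lenx] := ltnP x n.
  by have := eqNN' (Ordinal ltxn); rewrite !inE.
by apply/idP/idP => [/ltN|/ltN']; rewrite ltnNge lenx.
Qed.

Lemma prod1D_subsets (R : comPzRingType) (I : finType) (F : I -> R) :
  \prod_i (1 + F i) = \sum_(J : {set I}) \prod_(i in J) F i.
Proof.
under eq_bigr do rewrite addrC.
rewrite bigA_distr; apply: eq_bigr => J _.
by rewrite [RHS]big_mkcond.
Qed.

Lemma prod1D_le_expR (R : realType) (I : finType) (F : I -> R) :
  (forall i, 0 <= F i) -> \prod_i (1 + F i) <= expR (\sum_i F i).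
Proof.
move=> F0; rewrite expR_sum; apply: ler_prod => i _.
by rewrite expR_ge1Dx addr_ge0.
Qed.

(** Each tuple contributes t^m times its term to the expansion of the
    generating product, distinct tuples hit distinct subsets, and the subsets
    that are not hit contribute nonnegative terms. *)
Lemma sum_sorted_tuples_le (R : realType) (a : nat -> R) (A t : R) (m : nat)
    (s : seq (m.-tuple nat)) :
  (forall k, 0 <= a k) -> (forall n, \sum_(k < n) a k <= A) -> 0 < t ->
  uniq s -> (forall N, N \in s -> sorted ltn N) ->
  \sum_(N <- s) \prod_(i < m) a (tnth N i) <= expR (t * A) * t^-1 ^+ m.
Proof.
move=> a0 aA t0 us ss.
have [n ltn_s] : exists n, forall N, N \in s ->
    forall x, x \in tval N -> (x < n)%N.
  exists (\max_(N <- s) \max_(x <- tval N) x).+1 => N Ns x xN; rewrite ltnS.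
  have leN : (x <= \max_(y <- tval N) y)%N by exact: leq_bigmax_seq.
  apply: leq_trans leN _.
  exact: (@leq_bigmax_seq _ _ xpredT (fun N : m.-tuple nat => \max_(y <- tval N) y)%N).
rewrite exprVn ler_pdivlMr ?exprn_gt0// mulr_suml.
pose F (i : 'I_n) := t * a i.
have F0 i : 0 <= F i by rewrite mulr_ge0 ?a0 ?ltW.
have -> : \sum_(N <- s) (\prod_(i < m) a (tnth N i)) * t ^+ m =
    \sum_(J <- map (@support_below n m) s) \prod_(i in J) F i.
  rewrite big_map; apply: eq_big_seq => N Ns.
  rewrite -(prod_support_below (fun k => t * a k) (ss _ Ns) (ltn_s _ Ns)).
  by rewrite big_split /= prodr_const card_ord mulrC.
have usupp : uniq (map (@support_below n m) s).
  rewrite map_inj_in_uniq // => N N' Ns N's.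
  by apply: support_below_inj; [exact: ss|exact: ss|exact: ltn_s|exact: ltn_s].
apply: (@le_trans _ _ (\sum_(J : {set 'I_n}) \prod_(i in J) F i)).
  rewrite big_uniq //= [leLHS]big_mkcond; apply: ler_sum => J _.
  by case: ifP => // _; exact: prodr_ge0.
rewrite -prod1D_subsets (le_trans (prod1D_le_expR F0))//.
by rewrite ler_expR -mulr_sumr ler_pM2l.
Qed.

Lemma sum_inv_squares_le2 (R : realType) (n : nat) :
  \sum_(k < n) (k%:R ^+ 2)^-1 <= 2 :> R.
Proof.
(* The telescoping bound 2 - 1/n needs n >= 1, and its induction must start
   after the vanishing term k = 0, hence the shift by two. *)
have bound j : \sum_(k < j.+2) (k%:R ^+ 2)^-1 <= 2 - j.+1%:R^-1 :> R.
  elim: j => [|j IHj].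
    by rewrite !big_ord_recr big_ord0 /= expr0n invr0 expr1n invr1; lra.
  rewrite big_ord_recr /= (le_trans (lerD IHj (lexx _)))//.
  have j0 : 0 < j.+1%:R :> R by [].
  rewrite -[j.+2%:R]natr1; set x := j.+1%:R in j0 *.
  rewrite -subr_ge0.
  have -> : 2 - (x + 1)^-1 - (2 - x^-1 + ((x + 1) ^+ 2)^-1) =
      (x * (x + 1) ^+ 2)^-1 by field; rewrite !gt_eqF//; lra.
  by rewrite invr_ge0 mulr_ge0 ?sqr_ge0 // ltW.
apply: (@le_trans _ _ (\sum_(k < n.+2) (k%:R ^+ 2)^-1)).
  by rewrite !big_ord_recr /= -addrA lerDl addr_ge0 // invr_ge0 sqr_ge0.
by rewrite (le_trans (bound n))// gerBl invr_ge0.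
Qed.

(** The summand at k = 0 vanishes by the convention that 0 is its own inverse,
    so summing from 0 agrees with summing over positive integers. *)
Lemma sum_inv_powers_le2 (R : realType) (p n : nat) : (2 <= p)%N ->
  \sum_(k < n) (k%:R ^+ p)^-1 <= 2 :> R.
Proof.
move=> p2; apply: le_trans (sum_inv_squares_le2 R n); apply: ler_sum => -[k _] _ /=.
case: k => [|k]; first by rewrite !expr0n gtn_eqF ?invr0 // ltnW.
by rewrite lef_pV2 ?posrE ?exprn_gt0 // ler_weXn2l // ler1n.
Qed.

Lemma nested_series_ge0 (R : realType) (p m : nat) :
  (0 <= nested_series R p m)%E.
Proof.
by apply: esum_ge0 => N _; rewrite lee_fin prodr_ge0 // => i _; rewrite invr_ge0.
Qed.

Lemma nested_series_le (R : realType) (p m : nat) (t : R) :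
  (2 <= p)%N -> 0 < t ->
  (nested_series R p m <= (expR (t * 2) * t^-1 ^+ m)%:E)%E.
Proof.
move=> p2 t0; apply: ge_ereal_sup => _ [X [finX subX] <-].
rewrite fsbig_finite //= sumEFin lee_fin.
apply: (@sum_sorted_tuples_le _ (fun k => (k%:R ^+ p)^-1)) => //.
- by move=> n; exact: sum_inv_powers_le2.
- exact: finmap.fset_uniq.
- by move=> N; rewrite in_fset_set // inE => /subX [].
Qed.

Theorem theorem5p4 (R : realType) (p : nat) (hp : (2 <= p)%N) :
  (forall m : nat, (nested_series R p m < +oo)%E) /\
  nested_series R p m @[m --> \oo] --> 0%E.
Proof.
have le2 m := @nested_series_le R p m 2 hp (ltr0Sn _ 1).
split=> [m|]; first exact: le_lt_trans (le2 m) (ltry _).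
apply: (@squeeze_cvge _ _ _ _ (fun=> 0%E) _
  (fun m => (expR (2 * 2) * 2^-1 ^+ m)%:E)).
- by apply: nearW => m; rewrite nested_series_ge0 le2.
- exact: cvg_cst.
- apply: cvg_EFin; first exact: nearW.
  by apply: cvg_geometric; rewrite ger0_norm ?invf_lt1 // ltr1n.
Qed.
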